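(* Let $m\in\{2,3\}$ and suppose that the initial simplicial mesh $\mathcal T_h^0$ in dimension $m$ is conforming, shape-regular and quasi-uniform. There exists $\rho_*>0$, depending only on the shape-regularity (and quasi-uniformity) constants of $\mathcal T_h^0$, such that, if $0<\rho\le\rho_*$, the adjusted mesh $\mathcal T_h$ (obtained by the vertex displacement procedure with parameter $\rho$ defined in the context) remains conforming, shape-regular, and quasi-uniform. No simplex is inverted, and there are constants $c_1,C_1>0$, independent of $h$, such that $$c_1h\le h_T\le C_1h\qquad\text{for every }T\in\mathcal T_h.$$
   Context: $\Gamma=\{x\in\mathbb{R}^m:F(x)=0\}$ is a compact smooth regular level set ($\nabla F\ne0$ on $\Gamma$), $d$ is the signed distance function to $\Gamma$, $\pi_\Gamma$ the closest-point projection and $n=\nabla d$ the unit normal, defined in a tubular neighborhood of $\Gamma$. $\mathcal T_h^0$ is a simplicial background mesh (triangles for $m=2$, tetrahedra for $m=3$) with mesh size $h$ of a convex polygonal or polyhedral computational box; quasi-uniform means $c_{\rm m}h\le h_T\le C_{\rm m}h$ for every $T\in\mathcal T_h^0$, with $c_{\rm m},C_{\rm m}>0$ independent of $h$, $h_T=\operatorname{diam}(T)$. Vertex displacement with parameter $\rho>0$ independent of $h$: for each vertex $a$ of $\mathcal T_h^0$, set $\widetilde a=a$ if $|d(a)|\ge\rho h$, and $$\widetilde a=\pi_\Gamma(a)+\operatorname{sign}(d(a))\,\rho h\,n(\pi_\Gamma(a))\quad\text{if }|d(a)|<\rho h,$$ where if $d(a)=0$ a sign $\pm1$ is assigned by a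 fixed convention. It is understood that $\rho h$ is smaller than the reach of $\Gamma$, so that $\pi_\Gamma$ and $n$ are well defined where used. The adjusted mesh $\mathcal T_h$ is obtained by replacing every vertex $a$ by $\widetilde a$ and keeping the same connectivity. ''Inverted'' means the orientation (sign of the determinant of the edge matrix) of the simplex changes. *)

(* Defs.v *)
From HB Require Import structures.
From mathcomp Require Import all_boot all_order all_algebra.
From mathcomp Require Import all_classical all_reals all_analysis.

Set Implicit Arguments.
Unset Strict Implicit.
Unset Printing Implicit Defensive.

Import Order.TTheory GRing.Theory Num.Theory.
Import numFieldNormedType.Exports.

Local Open Scope classical_set_scope.
Local Open Scope ring_scope.

Section Euclidean.
Variables (R : realType) (m : nat).
Implicit Types (A : set 'rV[R]_m) (x y : 'rV[R]_m).

(* The norm `|x| of MathComp-Analysis on 'rV[R]_m is the sup norm; metric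
   quantities below use the Euclidean norm (same topology). *)
Definition enorm x : R := Num.sqrt (\sum_(i < m) x 0 i ^+ 2).

Definition dist_to A x : R := inf [set enorm (x - y) | y in A].

Definition nearest A x y : Prop := A y /\ enorm (x - y) = dist_to A x.

(* Meaningful where the nearest point exists and is unique; value x if there is
   no nearest point. *)
Definition proj A x : 'rV[R]_m := xget x [set y | nearest A x y].

(* Federer's reach; in \bar R since it may be infinite. *)
Definition reach A : \bar R :=
  ereal_sup [set r%:E | r in
    [set r : R | forall x, dist_to A x < r -> exists! y, nearest A x y]].

Definition diam A : R := sup [set enorm (x - y) | x in A & y in A].

Definition inball_diam A : R :=
  sup [set 2 * r | r in [set r : R | 0 <= r /\
        exists c, [set x | enorm (x - c) <= r] `<=` A]].

Definition hull (I : finType) (p : I -> 'rV[R]_m) (S : {set I}) :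
    set 'rV[R]_m :=
  [set x | exists w : I -> R, [/\ forall i, 0 <= w i,
     \sum_(i in S) w i = 1 & x = \sum_(i in S) w i *: p i]].

Definition convex_polytope (D : set 'rV[R]_m) : Prop :=
  exists (k : nat) (p : 'I_k -> 'rV[R]_m), D = hull p [set: 'I_k]%SET.

End Euclidean.

Section LevelSet.
Variables (R : realType) (m : nat).
Implicit Types (F f : 'rV[R]_m -> R) (x a : 'rV[R]_m).

Definition partial (i : 'I_m) f x : R := 'D_(delta_mx 0 i) f x.

Definition grad f x : 'rV[R]_m := \row_i partial i f x.

(* C^infinity on an open set U: every iterated partial derivative exists and is
   continuous at every point of U. *)
Definition smooth_on (U : set 'rV[R]_m) f : Prop :=
  forall (s : seq 'I_m) x, U x ->
    let g := foldr partial f s in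
    {for x, continuous g} /\ forall i : 'I_m, derivable g x (delta_mx 0 i).

Definition zero_set F : set 'rV[R]_m := [set x | F x = 0].

Definition compact_regular_level_set F : Prop :=
  [/\ continuous F,
      exists U : set 'rV[R]_m,
        [/\ open U, zero_set F `<=` U & smooth_on U F],
      compact (zero_set F), zero_set F !=set0
    & forall x, zero_set F x -> grad F x != 0].

(* Orientation convention: d is negative where F < 0, positive where F > 0. *)
Definition sdist F x : R := Num.sg (F x) * dist_to (zero_set F) x.

Definition normal F : 'rV[R]_m -> 'rV[R]_m := grad (sdist F).

(* s0 is the sign convention at points with d = 0: true for -1, false for +1. *)
Definition side F (s0 : 'rV[R]_m -> bool) a : R :=
  if sdist F a == 0 then (-1) ^+ s0 a else Num.sg (sdist F a).

Definition displace F (s0 : 'rV[R]_m -> bool) (rho h : R) a : 'rV[R]_m :=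
  if rho * h <= `|sdist F a| then a
  else let p := proj (zero_set F) a in
       p + (side F s0 a * (rho * h)) *: normal F p.

End LevelSet.

Section Mesh.
Variables (R : realType) (m : nat).

(* A mesh is a connectivity table (each cell lists its m+1 vertices in a fixed
   order, which is used only for orientations) plus vertex coordinates. *)
Record mesh := Mesh {
  vertex : finType;
  cell : finType;
  vert : cell -> 'I_m.+1 -> vertex;
  vert_inj : forall K, injective (vert K);
  cell_inj : injective (fun K => [set vert K i | i : 'I_m.+1]%SET);
  vertex_used : forall v, exists K i, vert K i = v;
  pos : vertex -> 'rV[R]_m
}.

Definition move_mesh (phi : 'rV[R]_m -> 'rV[R]_m) (M : mesh) : mesh :=
  {| vertex := vertex M; cell := cell M; vert := @vert M;
     vert_inj := @vert_inj M; cell_inj := @cell_inj M;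
     vertex_used := @vertex_used M; pos := phi \o @pos M |}.

Variable M : mesh.

Definition cell_vertices (K : cell M) : {set vertex M} :=
  [set vert K i | i : 'I_m.+1]%SET.

Definition simplex (K : cell M) : set 'rV[R]_m :=
  hull (@pos M) (cell_vertices K).

Definition edge_matrix (K : cell M) : 'M[R]_m :=
  \matrix_(i < m, j < m)
    (pos (vert K (lift ord0 i)) - pos (vert K ord0)) 0 j.

Definition orientation (K : cell M) : R := Num.sg (\det (edge_matrix K)).

Definition triangulates (D : set 'rV[R]_m) : Prop :=
  (forall K : cell M, orientation K != 0) /\
  \bigcup_(K in [set: cell M]) simplex K = D.

(* The case S = set0 is that of an empty intersection. *)
Definition conforming : Prop :=
  forall K L : cell M, exists S : {set vertex M},
    [/\ S \subset cell_vertices K, S \subset cell_vertices L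
      & simplex K `&` simplex L = hull (@pos M) S].

Definition shape_regular (sigma : R) : Prop :=
  forall K : cell M, diam (simplex K) <= sigma * inball_diam (simplex K).

Definition quasi_uniform (c C h : R) : Prop :=
  forall K : cell M, c * h <= diam (simplex K) <= C * h.

End Mesh.

(* Main.v *)
Require Import Defs.
From HB Require Import structures.
From mathcomp Require Import all_boot all_order all_algebra.
From mathcomp Require Import all_classical all_reals all_analysis.
From mathcomp Require Import ring lra.

(** The adjusted mesh is the image of the initial one under x |-> x + u x, where
    u is the piecewise affine interpolant of the vertex displacements. Everything
    follows once u is known to have Lipschitz constant 1/2 on the whole
    domain D.

    The signed distance is 1-Lipschitz, because a segment between opposite sides
    of the zero set crosses it (sdist_lipschitz). Hence the entries of the normal
    are at most 1 and no vertex moves by more than (1 + m) rho h (displace_le).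
    On a simplex containing a ball of radius r, an affine map bounded by delta at
    the vertices has gradient at most delta / r, as one sees on a diameter of the
    ball (barycenter_le_inball). Shape regularity and quasi-uniformity bound r
    from below by a multiple of h, so for small rho the gradient of u is at most
    1/2 on every cell. This is the notion of half perturbation.

    On one cell, identity plus u then changes lengths by factors between 1/2 and
    3/2. This controls diameters (diam_hull_compare) and inscribed balls
    (half_perturbation_ball). The orientation cannot change: when the vertices
    move linearly to their new positions, the simplex never degenerates, so its
    determinant keeps its sign (orientation_half_perturbation).

    Conformity is the global part. Two cells far apart in the connectivity could
    overlap after the displacement, and a bound on each cell says nothing about
    that. But conformity of the initial mesh makes u well defined and D is convex,
    so the segment between two points of D is covered by finitely many cells, on
    each of which u is 1/2-Lipschitz; adding up, u is 1/2-Lipschitz on D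
    (enorm_increment_closed_cover, interpolant_lipschitz). Therefore identity
    plus u is injective on D, and the intersection of the images of two cells is
    the image of their common face (conforming_half_perturbation). *)

Set Implicit Arguments.
Unset Strict Implicit.
Unset Printing Implicit Defensive.

Import Order.TTheory GRing.Theory Num.Theory.
Import numFieldNormedType.Exports.

Local Open Scope classical_set_scope.
Local Open Scope ring_scope.

(** * The Euclidean norm *)

Section EuclideanNorm.
Variables (R : realType) (m : nat).
Implicit Types (x y z : 'rV[R]_m).

Lemma enorm_ge0 x : 0 <= enorm x.
Proof. exact: sqrtr_ge0. Qed.

Lemma enorm_sqr x : enorm x ^+ 2 = \sum_(i < m) x 0 i ^+ 2.
Proof. by rewrite sqr_sqrtr// sumr_ge0// => i _; exact: sqr_ge0. Qed.

Lemma enormZ a x : enorm (a *: x) = `|a| * enorm x.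
Proof.
rewrite /enorm -sqrtr_sqr -sqrtrM ?sqr_ge0// mulr_sumr.
by congr Num.sqrt; apply: eq_bigr => i _; rewrite mxE exprMn.
Qed.

Lemma enormN x : enorm (- x) = enorm x.
Proof. by rewrite -scaleN1r enormZ normrN1 mul1r. Qed.

Lemma enorm0 : enorm (0 : 'rV[R]_m) = 0.
Proof. by rewrite -(scale0r 0) enormZ normr0 mul0r. Qed.

Lemma enorm_eq0 x : enorm x = 0 -> x = 0.
Proof.
move=> x0; apply/rowP => i; rewrite mxE; apply/eqP; rewrite -sqrf_eq0.
have /eqP := enorm_sqr x; rewrite x0 expr0n/= eq_sym psumr_eq0; last first.
  by move=> j _; exact: sqr_ge0.
by move=> /allP/(_ i); rewrite mem_index_enum => /(_ isT).
Qed.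

Lemma enormB x y : enorm (x - y) = enorm (y - x).
Proof. by rewrite -enormN opprB. Qed.

Lemma enorm_cauchy_schwarz x y :
  \sum_(i < m) x 0 i * y 0 i <= enorm x * enorm y.
Proof.
set c := \sum_(i < m) _.
have [y0|yn0] := eqVneq (enorm y) 0.
  have -> : c = 0.
    by rewrite /c (enorm_eq0 y0); apply: big1 => i _; rewrite mxE mulr0.
  by rewrite y0 mulr0.
have ygt0 : 0 < enorm y by rewrite lt_neqAle eq_sym yn0 enorm_ge0.
have b_gt0 : 0 < enorm y ^+ 2 by rewrite exprn_gt0.
(* b x - c y is b times the component of x orthogonal to y. *)
have : 0 <= \sum_(i < m) (enorm y ^+ 2 * x 0 i - c * y 0 i) ^+ 2.
  by apply: sumr_ge0 => i _; exact: sqr_ge0.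
under eq_bigr => i _.
  have -> : (enorm y ^+ 2 * x 0 i - c * y 0 i) ^+ 2 =
    (enorm y ^+ 2) ^+ 2 * x 0 i ^+ 2 +
    (- (2 * enorm y ^+ 2 * c) * (x 0 i * y 0 i) + c ^+ 2 * y 0 i ^+ 2).
    by ring.
  over.
rewrite !big_split/= -!mulr_sumr -!enorm_sqr -/c.
have -> : (enorm y ^+ 2) ^+ 2 * enorm x ^+ 2 +
    (- (2 * enorm y ^+ 2 * c) * c + c ^+ 2 * enorm y ^+ 2) =
    enorm y ^+ 2 * ((enorm x * enorm y) ^+ 2 - c ^+ 2) by ring.
rewrite pmulr_rge0// subr_ge0 => cs.
apply: (le_trans (ler_norm _)).
by rewrite -ler_sqr ?nnegrE ?mulr_ge0 ?enorm_ge0// real_normK ?num_real.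
Qed.

Lemma enormD x y : enorm (x + y) <= enorm x + enorm y.
Proof.
rewrite -ler_sqr ?nnegrE ?addr_ge0 ?enorm_ge0// enorm_sqr.
under eq_bigr => i _.
  have -> : (x + y) 0 i ^+ 2 =
    x 0 i ^+ 2 + (2 * (x 0 i * y 0 i) + y 0 i ^+ 2) by rewrite mxE; ring.
  over.
rewrite !big_split/= -!mulr_sumr -!enorm_sqr.
have := enorm_cauchy_schwarz x y; lra.
Qed.

Lemma enorm_trans y x z : enorm (x - z) <= enorm (x - y) + enorm (y - z).
Proof. by have := enormD (x - y) (y - z); rewrite addrA subrK. Qed.

Lemma enorm_sum (I : finType) (f : I -> 'rV[R]_m) :
  enorm (\sum_i f i) <= \sum_i enorm (f i).
Proof.
apply: (big_ind2 (fun u v => enorm u <= v)) => //; first by rewrite enorm0.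
by move=> u1 v1 u2 v2 le1 le2; rewrite (le_trans (enormD _ _)) ?lerD.
Qed.

Lemma enorm_delta (i : 'I_m) : enorm (delta_mx 0 i : 'rV[R]_m) = 1.
Proof.
rewrite /enorm (bigD1 i)//= big1 => [|j /negPf ji].
  by rewrite mxE !eqxx expr1n addr0 sqrtr1.
by rewrite mxE ji andbF expr0n.
Qed.

Lemma enorm_le_entries x c : (forall i, `|x 0 i| <= c) -> enorm x <= m%:R * c.
Proof.
move=> xc; rewrite (row_sum_delta x).
apply: (le_trans (enorm_sum _)).
apply: (@le_trans _ _ (\sum_(i < m) c)); last first.
  by rewrite sumr_const card_ord mulr_natl.
by apply: ler_sum => i _; rewrite enormZ enorm_delta mulr1.
Qed.

End EuclideanNorm.

(** * Size of the vertex displacement *)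

Section Displacement.
Variables (R : realType) (m : nat).
Implicit Types (A : set 'rV[R]_m) (x y z : 'rV[R]_m) (F : 'rV[R]_m -> R).

Lemma dist_to_ge0 A x : A !=set0 -> 0 <= dist_to A x.
Proof.
move=> [z Az]; apply: lb_le_inf; first by exists (enorm (x - z)), z.
by move=> _ [y _ <-]; exact: enorm_ge0.
Qed.

Lemma dist_to_le A x z : A z -> dist_to A x <= enorm (x - z).
Proof.
move=> Az; apply: ge_inf; last by exists z.
by exists 0 => _ [y _ <-]; exact: enorm_ge0.
Qed.

Lemma dist_to_lipschitz A x y :
  A !=set0 -> `|dist_to A x - dist_to A y| <= enorm (x - y).
Proof.
move=> A0; suff le_dist u v : dist_to A u <= enorm (u - v) + dist_to A v.
  have := le_dist x y; have := le_dist y x; rewrite (enormB y x) ler_norml.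
  lra.
rewrite -lerBlDl; apply: lb_le_inf.
  by case: A0 => z Az; exists (enorm (v - z)), z.
move=> _ [z Az <-]; rewrite lerBlDl.
exact: le_trans (dist_to_le u Az) (enorm_trans _ _ _).
Qed.

Lemma zero_on_segment F x y : continuous F -> F x * F y <= 0 ->
  exists2 t, 0 <= t <= 1 & F (x + t *: (y - x)) = 0.
Proof.
move=> cF Fxy; pose g t := F (x + t *: (y - x)).
have g0 : g 0 = F x by rewrite /g scale0r addr0.
have g1 : g 1 = F y by rewrite /g scale1r addrC subrK.
have cg : {within `[0, 1], continuous g}.
  apply: continuous_subspaceT => t.
  apply: (@continuous_comp _ _ _ (fun s : R => x + s *: (y - x)) F).
    by apply: cvgD; [exact: cvg_cst|apply: cvgZr_tmp; exact: cvg_id].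
  exact: cF.
have min0max : Num.min (g 0) (g 1) <= 0 <= Num.max (g 0) (g 1).
  rewrite g0 g1 ge_min le_max.
  have [Fx|Fx|_] := ltgtP (F x) 0; last by [].
  - by move: Fxy; rewrite nmulr_rle0// => ->.
  - by move: Fxy; rewrite pmulr_rle0// => ->; rewrite orbT.
have [t + gt0] := IVT ler01 cg min0max.
by rewrite in_itv/= => t01; exists t.
Qed.

(** Points on one side of the zero set compare through the distance function;
    between opposite sides the segment crosses the zero set, and both distances
    add up to at most its length. *)
Lemma sdist_lipschitz F x y : continuous F -> zero_set F !=set0 ->
  `|sdist F x - sdist F y| <= enorm (x - y).
Proof.
move=> cF F0.
have [Fxy|Fxy] := ltP 0 (F x * F y).
  have sg_eq : Num.sg (F x) = Num.sg (F y).
    have [Fx|Fx|Fx] := ltgtP (F x) 0; last by rewrite Fx mul0r ltxx in Fxy.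
    - by rewrite (nmulr_rgt0 _ Fx) in Fxy; rewrite !ltr0_sg.
    - by rewrite (pmulr_rgt0 _ Fx) in Fxy; rewrite !gtr0_sg.
  rewrite /sdist sg_eq -mulrBr normrM.
  apply: le_trans (dist_to_lipschitz x y F0).
  by rewrite ler_piMl// normr_sg lern1 leq_b1.
have [t /andP[t0 t1] Fz] := zero_on_segment cF Fxy.
have le_sdist u : `|sdist F u| <= dist_to (zero_set F) u.
  rewrite /sdist normrM (ger0_norm (dist_to_ge0 u F0)).
  by rewrite ler_piMl ?dist_to_ge0// normr_sg lern1 leq_b1.
have dx := @dist_to_le (zero_set F) x _ Fz.
have dy := @dist_to_le (zero_set F) y _ Fz.
have ex : enorm (x - (x + t *: (y - x))) = t * enorm (x - y).
  by rewrite opprD addrA subrr sub0r enormN enormZ ger0_norm// (enormB y).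
have ey : enorm (y - (x + t *: (y - x))) = (1 - t) * enorm (x - y).
  have -> : y - (x + t *: (y - x)) = (1 - t) *: (y - x).
    by rewrite opprD addrA scalerBl scale1r.
  by rewrite enormZ ger0_norm ?subr_ge0// (enormB y).
rewrite ex in dx; rewrite ey in dy.
apply: (le_trans (ler_normB _ _)).
have := le_sdist x; have := le_sdist y; lra.
Qed.

(** Difference quotients of a 1-Lipschitz function are at most 1; where they
    have no limit, the derivative takes the default value 0. *)
Lemma partial_sdist_le1 F i x : continuous F -> zero_set F !=set0 ->
  `|partial i (sdist F) x| <= 1.
Proof.
move=> cF F0; rewrite /partial /derive.
set q := (X in lim (X @ _)).
have qle t : `|q t| <= 1.
  rewrite /q/= normrZ; have [->|t0] := eqVneq t 0.
    by rewrite invr0 normr0 mul0r.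
  rewrite normrV ?unitfE// ler_pdivrMl ?normr_gt0// mulr1.
  apply: (le_trans (sdist_lipschitz _ _ cF F0)).
  by rewrite addrK enormZ enorm_delta mulr1.
have [cq|/dvgP ->] := pselect (cvg (q t @[t --> 0^'])); last by rewrite normr0.
rewrite ler_norml; apply/andP; split.
- by apply: limr_ge => //; near=> t; have := qle t; rewrite ler_norml => /andP[].
- by apply: limr_le => //; near=> t; have := qle t; rewrite ler_norml => /andP[].
Unshelve. all: by end_near. Qed.

(** Below the reach a nearest point exists, which makes the choice in the
    definition of the projection effective. *)
Lemma nearest_proj A x : ((dist_to A x)%:E < reach A)%E ->
  nearest A x (Defs.proj A x).
Proof.
move=> /ereal_sup_gt [_ [s sA <-]]; rewrite lte_fin => /sA [y [Ay _]].
by rewrite /Defs.proj; case: xgetP => [z _//|/(_ y)].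
Qed.

(** A displaced vertex moves by its distance to the zero set, which is less than
    rho h, and then by rho h along the normal, whose length is at most m because
    its entries are at most 1. *)
Lemma displace_le F s0 rho h a :
  continuous F -> zero_set F !=set0 -> 0 < rho * h ->
  ((rho * h)%:E < reach (zero_set F))%E ->
  enorm (displace F s0 rho h a - a) <= (1 + m%:R) * (rho * h).
Proof.
move=> cF F0 rh0 rh_reach; rewrite /displace.
case: (lerP (rho * h) `|sdist F a|) => [_|da].
  by rewrite subrr enorm0 mulr_ge0 ?addr_ge0 ?ler0n// ltW.
set p := Defs.proj _ a.
have dist_a : dist_to (zero_set F) a < rho * h.
  have [Fa|Fa] := eqVneq (F a) 0.
    apply: le_lt_trans rh0; apply: (le_trans (@dist_to_le (zero_set F) a a Fa)).
    by rewrite subrr enorm0.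
  move: da; rewrite /sdist normrM normr_sg Fa mul1r.
  by rewrite ger0_norm ?dist_to_ge0.
have [_ pa] : nearest (zero_set F) a p.
  by apply: nearest_proj; apply: lt_trans rh_reach; rewrite lte_fin.
have side1 : `|side F s0 a| <= 1.
  rewrite /side; case: ifP => _; first by rewrite normrX normrN1 expr1n.
  by rewrite normr_sg lern1 leq_b1.
have np : enorm (normal F p) <= m%:R.
  rewrite -[leRHS]mulr1; apply: enorm_le_entries => i.
  by rewrite mxE; exact: partial_sdist_le1.
rewrite addrAC (le_trans (enormD _ _))// mulrDl mul1r lerD//.
  by rewrite enormB pa ltW.
rewrite enormZ normrM (gtr0_norm rh0) mulrAC mulrC (mulrC _ (rho * h)).
rewrite ler_pM2l//; apply: le_trans np.
by rewrite ler_piMl ?enorm_ge0.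
Qed.

End Displacement.

(** * Lipschitz functions on a finite closed cover of an interval *)

(** From a, travel to the last point t1 of a closed set that contains a; beyond
    t1 the other sets still cover, and they cover t1 as well because their union
    is closed, so the rest of the interval needs one set fewer. *)
Lemma enorm_increment_closed_cover (R : realType) (m : nat) (I : finType)
    (g : R -> 'rV[R]_m) (A : I -> set R) (L : R) (s : seq I) (a b : R) :
  a <= b -> (forall i, closed (A i)) ->
  (forall t, a <= t <= b -> exists2 i, i \in s & A i t) ->
  (forall i x y, A i x -> A i y -> enorm (g x - g y) <= L * `|x - y|) ->
  enorm (g b - g a) <= L * (b - a).
Proof.
move=> ab clA cov lipA.
have [n les] := ubnP (size s); elim: n => // n IH in s a ab cov les *.
have [i si Aia] := cov a (introT andP (conj (lexx a) ab)).
pose B := A i `&` [set t | t <= b].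
have B0 : B !=set0 by exists a.
have ubB : ubound B b by move=> t [].
have hB : has_ubound B by exists b.
set t1 := sup B.
have t1b : t1 <= b by exact: ge_sup.
have at1 : a <= t1 by apply: ub_le_sup.
have [Ait1 _] : B t1.
  suff clB : closed B by apply: clB; exact: closure_sup.
  by apply: closedI; [exact: clA|exact: closed_le].
have step1 := lipA i t1 a Ait1 Aia.
rewrite (ger0_norm (_ : 0 <= t1 - a)) ?subr_ge0// in step1.
have [t1eb|t1nb] := eqVneq t1 b; first by rewrite -t1eb.
have t1ltb : t1 < b by rewrite lt_neqAle t1nb.
pose s' := rem i s.
have cov1 t : t1 < t <= b -> exists2 j, j \in s' & A j t.
  move=> /andP[t1t tb].
  have [|j sj Ajt] := cov t; first by rewrite tb andbT (le_trans at1)// ltW.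
  have ji : j != i.
    apply: contraTneq t1t => ji; rewrite -leNgt; apply: ub_le_sup => //.
    by split => //; rewrite -ji.
  by exists j => //; move: sj; rewrite (perm_mem (perm_to_rem si)) inE (negPf ji).
have cov' t : t1 <= t <= b -> exists2 j, j \in s' & A j t.
  move=> /andP[]; rewrite le_eqVlt => /predU1P[<- _|t1t tb]; last first.
    by apply: cov1; rewrite t1t.
  have clU : closed (\bigcup_(j in [set` s']) A j).
    by apply: closed_bigcup => // *; exact: finite_seq.
  suff [j sj Ajt] : (\bigcup_(j in [set` s']) A j) t1 by exists j.
  apply: clU => V /nbhs_ballP[e /= e0 eV].
  pose t' := Num.min (t1 + e / 2) b.
  have t1t' : t1 < t' by rewrite lt_min t1ltb ltrDl divr_gt0.
  have t'b : t' <= b by rewrite ge_min lexx orbT.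
  have t'e : t' <= t1 + e / 2 by rewrite ge_min lexx.
  have [|j sj Ajt'] := cov1 t'; first by rewrite t1t'.
  exists t'; split; first by exists j.
  apply: eV; rewrite /ball/= ltr_norml; lra.
have step2 : enorm (g b - g t1) <= L * (b - t1).
  apply: (IH s') => //.
  by rewrite size_rem//; case: (s) si les.
apply: (le_trans (enorm_trans (g t1) _ _)).
have -> : L * (b - a) = L * (b - t1) + L * (t1 - a) by ring.
exact: lerD.
Qed.

(** * Barycentric weights *)

Section Weights.
Variables (R : realType) (m : nat) (I : finType).
Implicit Types (p q : I -> 'rV[R]_m) (S T : {set I}) (w : I -> R).

(** Weights are functions on all indices that vanish outside S, so that weights
    of different cells of a mesh can be compared and added. *)
Definition supported S w := forall i, i \notin S -> w i = 0.

Definition barycenter p w : 'rV[R]_m := \sum_i w i *: p i.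

Definition convex_weights S w :=
  [/\ forall i, 0 <= w i, supported S w & \sum_i w i = 1].

Definition affinely_free p S := forall w, supported S w ->
  \sum_i w i = 0 -> barycenter p w = 0 -> forall i, w i = 0.

Lemma hullP p S x :
  hull p S x <-> exists2 w, convex_weights S w & barycenter p w = x.
Proof.
split=> [[w [w0 w1 ->]]|[w [w0 Sw w1] <-]]; last first.
  exists w; split => //.
    by rewrite -w1 [RHS](bigID (mem S))/= [X in _ + X]big1 ?addr0.
  rewrite /barycenter (bigID (mem S))/= [X in _ + X]big1 ?addr0//.
  by move=> i /Sw ->; rewrite scale0r.
exists (fun i => if i \in S then w i else 0); first split=> [i|i /negPf->|] //.
- by case: ifP.
- by rewrite -w1 -big_mkcond.
- rewrite /barycenter [RHS]big_mkcond; apply: eq_bigr => i _.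
  by case: ifP => _ //; rewrite scale0r.
Qed.

Lemma supportedS S T w : S \subset T -> supported S w -> supported T w.
Proof. by move=> /fintype.subsetP ST Sw i iT; apply: Sw; apply: contra iT => /ST. Qed.

Lemma supported_lin S a b w w' : supported S w -> supported S w' ->
  supported S (fun i => a * w i + b * w' i).
Proof. by move=> Sw Sw' i iS; rewrite Sw// Sw'// !mulr0 addr0. Qed.

Lemma sum_lin a b w w' :
  \sum_i (a * w i + b * w' i) = a * \sum_i w i + b * \sum_i w' i.
Proof. by rewrite big_split/= !mulr_sumr. Qed.

Lemma barycenter_lin p a b w w' :
  barycenter p (fun i => a * w i + b * w' i) =
  a *: barycenter p w + b *: barycenter p w'.
Proof.
rewrite /barycenter !scaler_sumr -big_split/=.
by apply: eq_bigr => i _; rewrite scalerDl !scalerA.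
Qed.

Lemma barycenterB p q w :
  barycenter (fun i => q i - p i) w = barycenter q w - barycenter p w.
Proof.
by rewrite /barycenter -sumrB; apply: eq_bigr => i _; rewrite scalerBr.
Qed.

Lemma convex_weights_mix S w w' t : 0 <= t <= 1 ->
  convex_weights S w -> convex_weights S w' ->
  convex_weights S (fun i => (1 - t) * w i + t * w' i).
Proof.
move=> /andP[t0 t1] [w0 Sw w1] [w'0 Sw' w'1]; split.
- by move=> i; rewrite addr_ge0 ?mulr_ge0 ?subr_ge0.
- exact: supported_lin.
- by rewrite sum_lin w1 w'1; ring.
Qed.

Lemma hull_convex p S x y t : 0 <= t <= 1 ->
  hull p S x -> hull p S y -> hull p S (x + t *: (y - x)).
Proof.
move=> t01 /hullP[w cw <-] /hullP[w' cw' <-]; apply/hullP.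
exists (fun i => (1 - t) * w i + t * w' i); first exact: convex_weights_mix.
by rewrite barycenter_lin scalerBl scale1r scalerBr addrAC addrA.
Qed.

Lemma barycenter_convex_le p S w c : convex_weights S w ->
  (forall i, enorm (p i) <= c) -> enorm (barycenter p w) <= c.
Proof.
move=> [w0 _ w1] pc; apply: (le_trans (enorm_sum _)).
rewrite -[leRHS]mul1r -w1 mulr_suml; apply: ler_sum => i _.
by rewrite enormZ ger0_norm// ler_wpM2l.
Qed.

Lemma affinely_free_inj p S w w' : affinely_free p S ->
  supported S w -> supported S w' -> \sum_i w i = \sum_i w' i ->
  barycenter p w = barycenter p w' -> w = w'.
Proof.
move=> free Sw Sw' sww' bww'; apply/funext => i; apply/eqP; rewrite -subr_eq0; apply/eqP.
have -> : w i - w' i = 1 * w i + -1 * w' i by ring.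
apply: (free (fun i => 1 * w i + -1 * w' i)).
- exact: supported_lin.
- by rewrite sum_lin sww'; ring.
- by rewrite barycenter_lin bww' scaleN1r scale1r subrr.
Qed.

(** * Diameter and inscribed balls of a hull *)

Let dists p S := [set enorm (x - y) | x in hull p S & y in hull p S].

Lemma dists_has_ubound p S : has_ubound (dists p S).
Proof.
exists (2 * \sum_i enorm (p i)).
move=> _ [_ /hullP[w cw <-] [_ /hullP[w' cw' <-] <-]].
have bnd i : enorm (p i) <= \sum_i enorm (p i).
  by rewrite (bigD1 i)//= lerDl sumr_ge0// => j _; exact: enorm_ge0.
apply: (le_trans (enormD _ _)); rewrite enormN.
have := barycenter_convex_le cw bnd; have := barycenter_convex_le cw' bnd; lra.
Qed.

Lemma le_diam_hull p S x y : hull p S x -> hull p S y ->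
  enorm (x - y) <= diam (hull p S).
Proof.
by move=> Sx Sy; apply: ub_le_sup; [exact: dists_has_ubound|exists x => //; exists y].
Qed.

Lemma vertex_in_hull p S i : i \in S -> hull p S (p i).
Proof.
move=> iS; apply/hullP; exists (fun j => (j == i)%:R).
  split=> [j||]; rewrite ?ler0n//.
    by move=> j; case: eqP => // ->; rewrite iS.
  by rewrite (bigD1 i)//= eqxx big1 ?addr0// => j /negPf->.
rewrite /barycenter (bigD1 i)//= eqxx scale1r big1 ?addr0// => j /negPf->.
by rewrite scale0r.
Qed.

Lemma diam_hull_le p S c : S != finset.set0 ->
  (forall x y, hull p S x -> hull p S y -> enorm (x - y) <= c) ->
  diam (hull p S) <= c.
Proof.
move=> /set0Pn[i iS] le_c; apply: ge_sup; last first.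
  by move=> _ [x Sx [y Sy <-]]; exact: le_c.
have Sp := vertex_in_hull p iS.
by exists (enorm (p i - p i)), (p i) => //; exists (p i).
Qed.

Lemma diam_hull_compare p q S c : S != finset.set0 ->
  (forall w, supported S w -> \sum_i w i = 0 ->
    enorm (barycenter p w) <= c * enorm (barycenter q w)) ->
  0 <= c -> diam (hull p S) <= c * diam (hull q S).
Proof.
move=> S0 pq c0; apply: diam_hull_le => //.
move=> _ _ /hullP[w cw <-] /hullP[w' cw' <-].
have [[_ Sw w1] [_ Sw' w'1]] := (cw, cw').
pose v i := 1 * w i + -1 * w' i.
have vB r : barycenter r v = barycenter r w - barycenter r w'.
  by rewrite /v barycenter_lin scale1r scaleN1r.
rewrite -vB; apply: (le_trans (pq v _ _)).
- exact: supported_lin.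
- by rewrite sum_lin w1 w'1; ring.
- by rewrite ler_wpM2l// vB; apply: le_diam_hull; apply/hullP;
    [exists w|exists w'].
Qed.

Lemma inball_le_diam p S r c : (0 < m)%N -> 0 <= r ->
  [set x | enorm (x - c) <= r] `<=` hull p S -> 2 * r <= diam (hull p S).
Proof.
move=> m0 r0 sub; pose e : 'rV[R]_m := delta_mx 0 (Ordinal m0).
have eE s : enorm (s *: e) = `|s| by rewrite enormZ enorm_delta mulr1.
have -> : 2 * r = enorm ((c + r *: e) - (c - r *: e)).
  have -> : (c + r *: e) - (c - r *: e) = (r + r) *: e.
    by rewrite scalerDl opprB addrC addrA subrK.
  by rewrite eE ger0_norm ?addr_ge0//; ring.
by apply: le_diam_hull; apply: sub => /=; rewrite addrC addKr ?enormN eE ger0_norm.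
Qed.

Lemma le_inball_diam p S r c : (0 < m)%N -> 0 <= r ->
  [set x | enorm (x - c) <= r] `<=` hull p S -> 2 * r <= inball_diam (hull p S).
Proof.
move=> m0 r0 sub; apply: ub_le_sup; last by exists r => //; split=> //; exists c.
exists (diam (hull p S)) => _ [s [s0 [c' sub']] <-].
exact: inball_le_diam sub'.
Qed.

Lemma inball_radius p S b : S != finset.set0 -> b < inball_diam (hull p S) ->
  exists c r, [/\ 0 <= r, b < 2 * r & [set x | enorm (x - c) <= r] `<=` hull p S].
Proof.
move=> /set0Pn[i iS] b_lt.
have [|_ [r [r0 [c sub]] <-] b2r] := sup_gt _ b_lt; last by exists c, r.
exists (2 * 0), 0 => //; split=> //; exists (p i) => x /= x_le0.
have -> : x = p i.
  apply/eqP; rewrite -subr_eq0; apply/eqP/enorm_eq0/le_anti.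
  by rewrite x_le0 enorm_ge0.
exact: vertex_in_hull.
Qed.

(** * Affine perturbations of a simplex *)

(** The reason why the size of the inscribed ball controls the gradient of an
    affine function on a simplex: a diameter of the ball parallel to a given
    vector has length 2 r, and its endpoints are convex combinations of the
    vertices, where the function is at most delta. *)
Lemma barycenter_le_inball p (e : I -> 'rV[R]_m) S c r delta w :
  affinely_free p S -> 0 < r ->
  [set x | enorm (x - c) <= r] `<=` hull p S ->
  (forall i, enorm (e i) <= delta) ->
  supported S w -> \sum_i w i = 0 ->
  enorm (barycenter e w) <= delta / r * enorm (barycenter p w).
Proof.
move=> free r0 sub e_le Sw w0; set v := barycenter p w.
have [v0|vn0] := eqVneq v 0.
  rewrite v0 enorm0 mulr0 /barycenter big1 ?enorm0// => i _.
  by rewrite (free w Sw w0 v0) scale0r.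
have s0 : 0 < enorm v.
  by rewrite lt_neqAle enorm_ge0 andbT eq_sym; apply: contra_neq vn0 => /enorm_eq0.
pose k := r / enorm v.
have k0 : 0 < k by rewrite divr_gt0.
have kv : enorm (k *: v) = r by rewrite enormZ gtr0_norm// divfK ?gt_eqF.
have /hullP[w1 cw1 b1] : hull p S (c + k *: v).
  by apply: sub; rewrite /= addrC addKr kv.
have /hullP[w2 cw2 b2] : hull p S (c - k *: v).
  by apply: sub; rewrite /= addrC addKr enormN kv.
have [[_ Sw1 t1] [_ Sw2 t2]] := (cw1, cw2).
have wE : (fun i => 1 * w1 i + -1 * w2 i) = (fun i => k * w i + k * w i).
  apply: (affinely_free_inj free).
  - exact: supported_lin.
  - exact: supported_lin.
  - by rewrite !sum_lin t1 t2 w0; ring.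
  - rewrite !barycenter_lin b1 b2 scale1r scaleN1r -/v opprB [RHS]addrC.
    by rewrite addrC addrA subrK.
have := barycenter_lin e 1 (-1) w1 w2.
rewrite wE barycenter_lin -scalerDl scale1r scaleN1r => /(congr1 (@enorm R m)).
rewrite enormZ (ger0_norm (addr_ge0 (ltW k0) (ltW k0))) => kE.
have := enormD (barycenter e w1) (- barycenter e w2).
rewrite -kE enormN => le_sum.
have le1 := barycenter_convex_le cw1 e_le.
have le2 := barycenter_convex_le cw2 e_le.
have le_k : k * enorm (barycenter e w) <= delta.
  by rewrite mulrDl in le_sum; lra.
rewrite -(ler_pM2l k0).
have -> // : k * (delta / r * enorm v) = delta.
by rewrite /k; field; rewrite !gt_eqF.
Qed.

(** Weights of sum 0 parametrize the vectors of the affine span of p, so this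
    says that the affine map sending p i to q i is the identity plus a map with
    Lipschitz constant 1/2. *)
Definition half_perturbation p q S := forall w, supported S w ->
  \sum_i w i = 0 ->
  enorm (barycenter (fun i => q i - p i) w) <= 2^-1 * enorm (barycenter p w).

Section HalfPerturbation.
Variables (p q : I -> 'rV[R]_m) (S : {set I}).
Hypothesis pq : half_perturbation p q S.

Lemma half_perturbation_le w : supported S w -> \sum_i w i = 0 ->
  enorm (barycenter q w) <= 3 / 2 * enorm (barycenter p w).
Proof.
move=> Sw w0; have := pq Sw w0; rewrite barycenterB.
have := enormD (barycenter p w) (barycenter q w - barycenter p w).
rewrite addrC subrK; lra.
Qed.

Lemma half_perturbation_ge w : supported S w -> \sum_i w i = 0 ->
  enorm (barycenter p w) <= 2 * enorm (barycenter q w).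
Proof.
move=> Sw w0; have := pq Sw w0; rewrite barycenterB enormB.
have := enormD (barycenter q w) (barycenter p w - barycenter q w).
rewrite addrC subrK; lra.
Qed.

Lemma half_perturbation_free : affinely_free p S -> affinely_free q S.
Proof.
move=> free w Sw w0 qw0; apply: free => //; apply/enorm_eq0/le_anti.
rewrite enorm_ge0 andbT; have := half_perturbation_ge Sw w0.
by rewrite qw0 enorm0 mulr0.
Qed.

(** The perturbed affine map is onto, and its inverse at most doubles distances:
    a point at distance at most r / 2 from the image of c comes from a point at
    distance at most r from c. *)
Lemma half_perturbation_ball c r : affinely_free p S ->
  (forall y, exists2 w, supported S w &
     \sum_i w i = 1 /\ barycenter q w = y) -> 0 <= r ->
  [set x | enorm (x - c) <= r] `<=` hull p S ->
  exists c', [set y | enorm (y - c') <= r / 2] `<=` hull q S.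
Proof.
move=> free span r0 sub.
have /hullP[wc [_ Swc wc1] wcE] : hull p S c.
  by apply: sub; rewrite /= subrr enorm0.
exists (barycenter q wc) => y /= yc.
have [w Sw [w1 wE]] := span y.
pose v i := 1 * w i + -1 * wc i.
have vB s : barycenter s v = barycenter s w - barycenter s wc.
  by rewrite /v barycenter_lin scale1r scaleN1r.
have Sv : supported S v by exact: supported_lin.
have v0 : \sum_i v i = 0 by rewrite sum_lin w1 wc1; ring.
have /hullP[w' cw' w'E] : hull p S (barycenter p w).
  apply: sub => /=; rewrite -wcE -vB; have := half_perturbation_ge Sv v0.
  rewrite (vB q) wE; lra.
apply/hullP; exists w' => //; have [_ Sw' w'1] := cw'.
rewrite -wE; congr (barycenter q).
by apply: (affinely_free_inj free) => //; rewrite w1.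
Qed.

Lemma half_perturbation_partway t : 0 <= t <= 1 ->
  half_perturbation p (fun i => p i + t *: (q i - p i)) S.
Proof.
move=> /andP[t0 t1] w Sw w0.
have -> : barycenter (fun i => p i + t *: (q i - p i) - p i) w =
          t *: barycenter (fun i => q i - p i) w.
  rewrite /barycenter scaler_sumr; apply: eq_bigr => i _.
  by rewrite addrAC subrr add0r !scalerA mulrC.
rewrite enormZ ger0_norm//; apply: le_trans (pq Sw w0).
by rewrite ler_piMl ?enorm_ge0.
Qed.

End HalfPerturbation.

End Weights.

(** * Simplices of a mesh *)

Section Cells.
Variables (R : realType) (m : nat).
Implicit Types (M : mesh R m).

Lemma sum_cell (V : nmodType) M (K : cell M) (f : vertex M -> V) :
  (forall v, v \notin cell_vertices K -> f v = 0) ->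
  \sum_v f v = \sum_(i < m.+1) f (vert K i).
Proof.
move=> f0; rewrite (bigID (mem (cell_vertices K)))/= [X in _ + X]big1 ?addr0//.
by rewrite big_imset//= => i j _ _; exact: vert_inj.
Qed.

(** Separating the first vertex turns statements about weights into statements
    about the edge matrix. *)
Lemma barycenter_cell M (K : cell M) w : supported (cell_vertices K) w ->
  barycenter (@pos _ _ M) w = (\sum_v w v) *: pos (vert K ord0) +
    (\row_i w (vert K (lift ord0 i))) *m edge_matrix K.
Proof.
move=> Sw; rewrite /barycenter (sum_cell Sw) (@sum_cell _ _ K); last first.
  by move=> v /Sw ->; rewrite scale0r.
rewrite !big_ord_recl/= mulmx_sum_row scalerDl -addrA scaler_suml -big_split/=.
congr (_ + _); apply: eq_bigr => i _; rewrite mxE.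
have -> : row i (edge_matrix K) =
    pos (vert K (lift ord0 i)) - pos (vert K ord0).
  by apply/rowP => j; rewrite !mxE.
by rewrite scalerBr addrC subrK.
Qed.

Lemma cell_weights M (K : cell M) (t : R) (x : 'rV[R]_m) :
  exists2 w, supported (cell_vertices K) w &
    \sum_v w v = t /\ \row_i w (vert K (lift ord0 i)) = x.
Proof.
pose f i := if unlift ord0 i is Some j then x 0 j else t - \sum_j x 0 j.
pose w v := \sum_(i | vert K i == v) f i.
have wE i : w (vert K i) = f i.
  rewrite /w (big_pred1 i)// => j; exact: (inj_eq (@vert_inj _ _ M K)).
have Sw : supported (cell_vertices K) w.
  move=> v vK; rewrite /w big1// => i /eqP vi.
  by case/negP: vK; apply/imsetP; exists i.
exists w => //; split; last first.
  by apply/rowP => j; rewrite mxE wE /f liftK.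
rewrite (sum_cell Sw) big_ord_recl (eq_bigr (x 0)) => [|j _].
  by rewrite wE /f unlift_none subrK.
by rewrite wE /f liftK.
Qed.

Lemma orientation_neq0 M (K : cell M) :
  orientation K != 0 <-> affinely_free (@pos _ _ M) (cell_vertices K).
Proof.
rewrite /orientation sgr_eq0; split=> [detK w Sw w0|free].
  rewrite (barycenter_cell Sw) w0 scale0r add0r => rowE.
  have row0 : \row_i w (vert K (lift ord0 i)) = 0.
    by apply/eqP; apply: contraNT detK => rown0; apply/det0P; eexists; eauto.
  have lift0 j : w (vert K (lift ord0 j)) = 0.
    by have := congr1 (fun u : 'rV_m => u 0 j) row0; rewrite !mxE.
  move=> v; have [/imsetP[i _ ->]|/Sw//] := boolP (v \in cell_vertices K).
  case: (unliftP ord0 i) => [j ->|->]; first exact: lift0.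
  by move: w0; rewrite (sum_cell Sw) big_ord_recl big1 ?addr0// => j _; exact: lift0.
apply/negP => /det0P[x xn0 xE].
have [w Sw [w0 wx]] := cell_weights K 0 x.
case/negP: xn0; apply/eqP; rewrite -wx; apply/rowP => j; rewrite !mxE.
by apply: free => //; rewrite (barycenter_cell Sw) w0 wx scale0r add0r.
Qed.

Lemma cell_span M (K : cell M) : orientation K != 0 ->
  forall y, exists2 w, supported (cell_vertices K) w &
    \sum_v w v = 1 /\ barycenter (@pos _ _ M) w = y.
Proof.
rewrite /orientation sgr_eq0 => detK y.
have [w Sw [w1 wx]] :=
  cell_weights K 1 ((y - pos (vert K ord0)) *m invmx (edge_matrix K)).
exists w => //; split=> //.
by rewrite (barycenter_cell Sw) w1 wx mulmxKV ?unitmxE ?unitfE// scale1r addrC subrK.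
Qed.

Lemma cell_vertices_neq0 M (K : cell M) : cell_vertices K != finset.set0.
Proof. by apply/set0Pn; exists (vert K ord0); apply/imsetP; exists ord0. Qed.

(** The determinant is a polynomial in t, so a change of sign would give a
    root. *)
Lemma sgr_det_segment n (E E' : 'M[R]_n) :
  (forall t, 0 <= t <= 1 -> \det (E + t *: (E' - E)) != 0) ->
  Num.sg (\det E') = Num.sg (\det E).
Proof.
move=> det_neq0.
pose P : {poly R} :=
  \det (map_mx polyC E + 'X *: map_mx polyC (E' - E)).
have PE t : P.[t] = \det (E + t *: (E' - E)).
  rewrite -horner_evalE -det_map_mx; congr (\det _).
  by apply/matrixP => i j; rewrite !mxE /= horner_evalE !hornerE.
have P0 : P.[0] = \det E by rewrite PE scale0r addr0.
have P1 : P.[1] = \det E' by rewrite PE scale1r addrC subrK.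
have noroot (Q : {poly R}) : (forall t, `|Q.[t]| = `|P.[t]|) ->
    ~ (Q.[0] <= 0 <= Q.[1]).
  move=> QP /(poly_ivt ler01)[t /det_neq0 + /rootP Qt].
  by rewrite -PE -normr_eq0 -QP Qt normr0 eqxx.
rewrite -P0 -P1.
have [P01|P01] := ltP 0 (P.[0] * P.[1]).
  have [p0|p0|p0] := ltgtP P.[0] 0; last by rewrite p0 mul0r ltxx in P01.
  - by rewrite (nmulr_rgt0 _ p0) in P01; rewrite !ltr0_sg.
  - by rewrite (pmulr_rgt0 _ p0) in P01; rewrite !gtr0_sg.
exfalso; have [p0|p0] := leP P.[0] 0.
  apply: (noroot P) => //; rewrite p0/=.
  have {p0} : P.[0] < 0.
    by rewrite lt_neqAle p0 andbT PE; apply: det_neq0; rewrite lexx ler01.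
  by move=> p0; rewrite nmulr_rle0 in P01.
apply: (noroot (- P)) => [t|]; rewrite !hornerN ?normrN//.
by rewrite oppr_le0 oppr_ge0 (ltW p0)/=; rewrite pmulr_rle0 in P01.
Qed.

(** All the vertices can be moved linearly to their final positions: at every
    intermediate time the simplex is a half perturbation, hence nondegenerate. *)
Lemma orientation_half_perturbation M (phi : 'rV[R]_m -> 'rV[R]_m) (K : cell M) :
  orientation K != 0 ->
  half_perturbation (@pos _ _ M) (phi \o @pos _ _ M) (cell_vertices K) ->
  @orientation R m (move_mesh phi M) K = orientation K.
Proof.
move=> /orientation_neq0 free half; apply: sgr_det_segment => t t01.
pose phit x := x + t *: (phi x - x).
have -> : edge_matrix K + t *: (@edge_matrix _ _ (move_mesh phi M) K - edge_matrix K)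
    = @edge_matrix _ _ (move_mesh phit M) K.
  by apply/matrixP => i j; rewrite /phit !mxE/=; ring.
rewrite -sgr_eq0; apply/orientation_neq0.
exact: half_perturbation_free (half_perturbation_partway half t01) free.
Qed.

End Cells.

(** * Injectivity of the displacement of the whole mesh *)

Section Conformity.
Variables (R : realType) (m : nat) (M : mesh R m) (D : set 'rV[R]_m).
Hypotheses (triM : triangulates M D) (convD : convex_polytope D)
  (confM : conforming M).
Let p := @pos _ _ M.

Lemma cell_free (K : cell M) : affinely_free p (cell_vertices K).
Proof. by apply/orientation_neq0; case: triM. Qed.

(** The two cells meet in a common face, on which weights are unique for each
    of them. *)
Lemma mesh_weights_unique (K L : cell M) w w' :
  convex_weights (cell_vertices K) w -> convex_weights (cell_vertices L) w' ->
  barycenter p w = barycenter p w' -> w = w'.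
Proof.
move=> cw cw' ww'; have [S [SK SL KL]] := confM K L.
have [_ Kw w1] := cw; have [_ Lw' w'1] := cw'.
have /hullP[v [_ Sv v1] vE] : hull p S (barycenter p w).
  by rewrite -KL; split; apply/hullP; [exists w|rewrite ww'; exists w'].
apply: (@etrans _ _ v).
  by apply: (affinely_free_inj (@cell_free K)) => //;
    [exact: supportedS Sv|rewrite v1].
by apply: (affinely_free_inj (@cell_free L)) => //;
  [exact: supportedS Sv|rewrite v1|rewrite vE].
Qed.

(** In barycentric coordinates a cell is given by finitely many inequalities
    that are affine along the segment. *)
Lemma closed_segment_cell (K : cell M) (x y : 'rV[R]_m) :
  closed [set t : R | simplex K (x + t *: (y - x))].
Proof.
have orK : orientation K != 0 by case: triM.
have [wx Swx [wx1 wxE]] := cell_span orK x.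
have [wy Swy [wy1 wyE]] := cell_span orK y.
pose w t v := (1 - t) * wx v + t * wy v.
have Sw t : supported (cell_vertices K) (w t) by exact: supported_lin.
have w1 t : \sum_v w t v = 1 by rewrite sum_lin wx1 wy1; ring.
have wE t : barycenter p (w t) = x + t *: (y - x).
  by rewrite barycenter_lin wxE wyE scalerBl scale1r scalerBr addrAC addrA.
have -> : [set t : R | simplex K (x + t *: (y - x))] =
    \bigcap_v ((fun t => w t v) @^-1` [set s : R | 0 <= s]).
  apply/seteqP; split=> [t /hullP[w' [w'0 Sw' w'1] w'E] v _ /=|t /= w0].
    rewrite (_ : w t = w')//.
    by apply: (affinely_free_inj (@cell_free K)) => //; rewrite ?w1// wE.
  by apply/hullP; exists (w t) => //; split=> // v; exact: w0.
apply: closed_bigI => v _; apply: preimage_closed; last exact: closed_ge.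
move=> t _; apply: cvgD; apply: cvgM; try exact: cvg_cst; try exact: cvg_id.
by apply: cvgB; [exact: cvg_cst|exact: cvg_id].
Qed.

Variable e : vertex M -> 'rV[R]_m.

(** The choice of the cell is harmless: in a conforming mesh all cells containing
    x give it the same weights. *)
Definition interpolant (x : 'rV[R]_m) : 'rV[R]_m :=
  barycenter e (xget (fun=> 0) [set w | exists2 K : cell M,
    convex_weights (cell_vertices K) w & barycenter p w = x]).

Lemma interpolant_barycenter (K : cell M) w :
  convex_weights (cell_vertices K) w ->
  interpolant (barycenter p w) = barycenter e w.
Proof.
move=> cw; rewrite /interpolant; case: xgetP => [w' _ [L cw' ww']|no].
  by congr (barycenter e); apply: mesh_weights_unique cw' cw ww'.
by case: (no w); exists K.
Qed.

Variable L : R.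
Hypothesis lip_cell : forall (K : cell M) w, supported (cell_vertices K) w ->
  \sum_v w v = 0 -> enorm (barycenter e w) <= L * enorm (barycenter p w).

Lemma interpolant_lipschitz_cell (K : cell M) x y : simplex K x -> simplex K y ->
  enorm (interpolant x - interpolant y) <= L * enorm (x - y).
Proof.
move=> /hullP[w cw <-] /hullP[w' cw' <-].
rewrite (interpolant_barycenter cw) (interpolant_barycenter cw').
have [[_ Sw w1] [_ Sw' w'1]] := (cw, cw').
have := @lip_cell K (fun v => 1 * w v + -1 * w' v).
rewrite !barycenter_lin !scale1r !scaleN1r; apply.
- exact: supported_lin.
- by rewrite sum_lin w1 w'1; ring.
Qed.

(** Convexity of the domain makes the bound on each cell global: the segment
    between two points is covered by cells. *)
Lemma interpolant_lipschitz x y : D x -> D y ->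
  enorm (interpolant y - interpolant x) <= L * enorm (y - x).
Proof.
move=> Dx Dy.
pose g t := interpolant (x + t *: (y - x)).
have -> : interpolant x = g 0 by rewrite /g scale0r addr0.
have -> : interpolant y = g 1 by rewrite /g scale1r addrC subrK.
rewrite -[leRHS]mulr1 -[X in _ * X](subr0 1).
apply: (@enorm_increment_closed_cover _ _ (cell M) g
  (fun K => [set t : R | simplex K (x + t *: (y - x))]) _ (enum (cell M))) => //.
- by move=> K; exact: closed_segment_cell.
- move=> t t01; have Dt : D (x + t *: (y - x)).
    by move: convD Dx Dy => [k [c ->]]; exact: hull_convex.
  have [_ triD] := triM; rewrite -triD in Dt; have [K _ Kt] := Dt.
  by exists K => //; rewrite mem_enum.
- move=> K s t Ks Kt; apply: (le_trans (interpolant_lipschitz_cell Ks Kt)).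
  have -> : x + s *: (y - x) - (x + t *: (y - x)) = (s - t) *: (y - x).
    by rewrite opprD addrACA subrr add0r scalerBl.
  by rewrite enormZ mulrA mulrAC.
Qed.

End Conformity.

(** The perturbed cells are the images of the cells under the identity plus the
    interpolated displacement, which is injective on D because the displacement
    contracts distances. *)
Lemma conforming_half_perturbation (R : realType) (m : nat) (M : mesh R m)
    (D : set 'rV[R]_m) (phi : 'rV[R]_m -> 'rV[R]_m) :
  triangulates M D -> convex_polytope D -> conforming M ->
  (forall K : cell M,
    half_perturbation (@pos _ _ M) (phi \o @pos _ _ M) (cell_vertices K)) ->
  conforming (move_mesh phi M).
Proof.
move=> triM convD confM half K L.
have [S [SK SL KL]] := confM K L; exists S; split=> //.
set p := @pos _ _ M in half KL; set q := phi \o p in half.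
have inD (J : cell M) w : convex_weights (cell_vertices J) w ->
    D (barycenter p w).
  by move=> cw; have [_ <-] := triM; exists J => //; apply/hullP; exists w.
apply/seteqP; split=> x; last first.
  by move=> /hullP[w [w0 Sw w1] <-]; split; apply/hullP;
    exists w => //; split=> //; exact: supportedS Sw.
move=> [/hullP[w cw <-] /hullP[w' cw' ww']].
have lip := interpolant_lipschitz triM convD confM half
  (inD _ _ cw) (inD _ _ cw').
rewrite !(interpolant_barycenter triM confM _ cw)
  !(interpolant_barycenter triM confM _ cw') !barycenterB in lip.
have pE : barycenter p w' = barycenter p w.
  apply/eqP; rewrite -subr_eq0; apply/eqP/enorm_eq0/le_anti.
  rewrite enorm_ge0 andbT; move: lip; rewrite [barycenter q w']ww'.
  rewrite opprB addrC addrA subrK (enormB (barycenter p w)).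
  lra.
have /hullP[v cv vE] : hull p S (barycenter p w).
  by rewrite -KL; split; apply/hullP; [exists w|rewrite -pE; exists w'].
apply/hullP; exists v => //; congr (barycenter _ _).
apply: (@mesh_weights_unique _ _ _ _ triM confM K K) cw vE.
by have [v0 Sv v1] := cv; split=> //; exact: supportedS Sv.
Qed.

(** * The adjusted mesh *)

(** The gradient of the interpolated displacement is at most delta / r, hence at
    most 1/2. *)
Lemma regular_cell_half_perturbation (R : realType) (m : nat) (M : mesh R m)
    (K : cell M) (phi : 'rV[R]_m -> 'rV[R]_m) c r delta :
  orientation K != 0 -> 0 < r -> delta <= r / 2 ->
  [set x | enorm (x - c) <= r] `<=` simplex K ->
  (forall a, enorm (phi a - a) <= delta) ->
  half_perturbation (@pos _ _ M) (phi \o @pos _ _ M) (cell_vertices K).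
Proof.
move=> /orientation_neq0 free r0 dr sub phi_le w Sw w0.
apply: (le_trans (barycenter_le_inball free r0 sub (fun i => phi_le _) Sw w0)).
by rewrite ler_wpM2r ?enorm_ge0// ler_pdivrMr// mulrC.
Qed.

Theorem lemma2p2 (R : realType) (m : nat) (hm : m = 2%N \/ m = 3%N)
    (sigma cm Cm : R) (sigma_gt0 : 0 < sigma) (cm_gt0 : 0 < cm)
    (Cm_gt0 : 0 < Cm) :
  exists2 rho_star : R, 0 < rho_star &
  forall (F : 'rV[R]_m -> R) (s0 : 'rV[R]_m -> bool) (D : set 'rV[R]_m)
         (rho : R),
    compact_regular_level_set F ->
    convex_polytope D ->
    0 < rho -> rho <= rho_star ->
    exists sigma1 c1 C1 : R,
      [/\ 0 < sigma1, 0 < c1, 0 < C1 &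
      forall (h : R) (M0 : mesh R m),
        0 < h ->
        ((rho * h)%:E < reach (zero_set F))%E ->
        triangulates M0 D ->
        conforming M0 ->
        shape_regular M0 sigma ->
        quasi_uniform M0 cm Cm h ->
        let M := move_mesh (displace F s0 rho h) M0 in
        [/\ conforming M,
            shape_regular M sigma1,
            quasi_uniform M c1 C1 h
          & forall K : cell M0, @orientation R m M K = orientation K]].
Proof.
have m0 : (0 < m)%N by case: hm => ->.
(* Shape regularity and quasi-uniformity give every cell a ball of radius larger
   than cm h / (4 sigma), and vertices move by at most (1 + m) rho h; rho_star
   makes the second length half of the first. *)
have k0 : 0 < 1 + m%:R :> R by rewrite ltr_pwDl.
exists (cm / (8 * sigma * (1 + m%:R))).
  by rewrite divr_gt0// !mulr_gt0.
move=> F s0 D rho [cF _ _ F0 _] convD rho0 rho_le.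
exists (6 * sigma * Cm / cm), (cm / 2), (3 / 2 * Cm).
split; rewrite ?divr_gt0 ?mulr_gt0//.
move=> h M0 h0 rh_reach triM confM shapeM quasiM M.
set phi := displace F s0 rho h.
have phi_le a : enorm (phi a - a) <= (1 + m%:R) * (rho * h).
  by apply: displace_le => //; rewrite mulr_gt0.
have delta_le : (1 + m%:R) * (rho * h) <= cm * h / (8 * sigma).
  have -> : cm * h / (8 * sigma) =
      (1 + m%:R) * (cm / (8 * sigma * (1 + m%:R)) * h).
    by field; rewrite !gt_eqF.
  by rewrite ler_wpM2l ?ler_wpM2r// ltW.
have orM (K : cell M0) : orientation K != 0 by case: triM.
(* The inscribed diameter is at least cm h / sigma; half of it is attained by
   an actual ball although the supremum need not be. *)
have ball (K : cell M0) : exists c r, cm * h / (4 * sigma) < r /\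
    [set x | enorm (x - c) <= r] `<=` simplex K.
  have [||c [r [_ br sub]]] := @inball_radius _ _ _ (@pos _ _ M0)
      (cell_vertices K) (cm * h / (2 * sigma)).
  - exact: cell_vertices_neq0.
  - rewrite ltr_pdivrMr ?mulr_gt0//.
    have /andP[q1 _] := quasiM K; have s1 := shapeM K.
    have ch : 0 < cm * h by rewrite mulr_gt0.
    rewrite /simplex in q1 s1; nra.
  - exists c, r; split=> //.
    have <- : cm * h / (2 * sigma) / 2 = cm * h / (4 * sigma).
      by field; rewrite gt_eqF.
    lra.
have rpos : 0 < cm * h / (4 * sigma) by rewrite divr_gt0 ?mulr_gt0.
have delta_le' r : cm * h / (4 * sigma) < r ->
    (1 + m%:R) * (rho * h) <= r / 2.
  have e8 : cm * h / (4 * sigma) / 2 = cm * h / (8 * sigma).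
    by field; rewrite gt_eqF.
  lra.
have half (K : cell M0) : half_perturbation (@pos _ _ M0)
    (phi \o @pos _ _ M0) (cell_vertices K).
  have [c [r [rb sub]]] := ball K.
  exact: regular_cell_half_perturbation (lt_trans rpos rb) (delta_le' r rb) sub phi_le.
have orE (K : cell M0) : @orientation R m M K = orientation K.
  exact: orientation_half_perturbation.
have diam_le (K : cell M0) :
    diam (@simplex _ _ M K) <= 3 / 2 * diam (simplex K).
  apply: diam_hull_compare; [exact: cell_vertices_neq0| |lra].
  exact: half_perturbation_le (half K).
have diam_ge (K : cell M0) : diam (simplex K) <= 2 * diam (@simplex _ _ M K).
  apply: diam_hull_compare; [exact: cell_vertices_neq0| |lra].
  exact: half_perturbation_ge (half K).
split=> // [|K|K].
- exact: conforming_half_perturbation triM convD confM half.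
- have [c [r [rb sub]]] := ball K; have r0 := lt_trans rpos rb.
  have [|c' sub'] := half_perturbation_ball (half K)
    (iffLR (orientation_neq0 _) (orM K)) _ (ltW r0) sub.
    by apply: (@cell_span _ _ M K); rewrite orE.
  have r2 : 0 <= r / 2 by rewrite divr_ge0// ltW.
  have in_le := le_inball_diam m0 r2 sub'.
  have /andP[_ q2] := quasiM K; have d1 := diam_le K.
  have -> : 6 * sigma * Cm / cm * inball_diam (@simplex _ _ M K) =
      3 / 2 * (Cm * (4 * sigma / cm * inball_diam (@simplex _ _ M K))).
    by field; rewrite gt_eqF.
  have h_le : h <= 4 * sigma / cm * inball_diam (@simplex _ _ M K).
    have -> : h = 4 * sigma / cm * (cm * h / (4 * sigma)).
      by field; rewrite !gt_eqF.
    rewrite ler_wpM2l ?divr_ge0 ?mulr_ge0 ?(ltW sigma_gt0) ?(ltW cm_gt0)//.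
    apply: le_trans in_le; lra.
  apply: (le_trans d1); rewrite ler_pM2l ?divr_gt0//.
  by apply: (le_trans q2); rewrite ler_wpM2l// ltW.
- have /andP[q1 q2] := quasiM K; have d1 := diam_le K; have d2 := diam_ge K.
  apply/andP; split; lra.
Qed.
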